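(* Let $H$ be a Hopf algebra with bijective antipode, $A$ a right $H$-comodule Poisson 3-Lie algebra, and $B=A^{AcoH}$. Let $M$ be a Poisson 3-Lie $(A,H)$-Hopf module. Assume that there is a right $H$-colinear algebra map $\phi:H\to A^A$ and that $M^{coH}$ and $A^{coH}$ are trivial 3-Lie $A$-modules under $\diamond'$ (i.e. $(x,y)\diamond' m=0$ and $(x,y)\diamond' a=0$ for all $x,y\in A$, $m\in M^{coH}$, $a\in A^{coH}$). Then the functor $$G=(-)^{AcoH}:{}_{\mathcal{P}A}\mathcal{M}^H\to{}_B\mathcal{M},\qquad N\mapsto N^{AcoH},$$ is dual Maschke, that is, every object of ${}_{\mathcal{P}A}\mathcal{M}^H$ is $G$-relative projective.
   Context: Everything is over a fixed field $k$ of characteristic 0; algebras are associative and unital and algebra maps are unital. $H$ is a Hopf algebra with antipode $S$ and $\Delta(h)=h_1\otimes h_2$; right $H$-coactions are written $\rho(m)=m_{(0)}\otimes m_{(1)}$, and $M^{coH}=\{m\in M: \rho(m)=m\otimes 1_H\}$. $H$ is a right $H$-comodule via $\Delta$. A 3-Lie algebra is a vector space $A$ with a skew-symmetric trilinear bracket $\{-,-,-\}:A^{\otimes 3}\to A$ satisfying $\{\{x,y,z\},u,v\}=\{\{x,u,v\},y,z\}+\{\{y,u,v\},z,x\}+\{\{z,u,v\},x,y\}$. A 3-Lie $A$-module is a vector space $M$ with a trilinear map $A\times A\times M\to M$, $(x,y,m)\mapsto (x,y)\diamond m$, such that $(x,y)\diamond m=-(y,x)\diamond m$; $(x,y)\diamond((u,v)\diamond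 m)-(u,v)\diamond((x,y)\diamond m)=(\{x,y,u\},v)\diamond m+(u,\{x,y,v\})\diamond m$; $(\{x,y,u\},v)\diamond m=(y,u)\diamond((x,v)\diamond m)-(x,u)\diamond((y,v)\diamond m)+(x,y)\diamond((u,v)\diamond m)$. A Poisson 3-Lie algebra is a commutative associative algebra $A$ with a 3-Lie bracket such that $\{x,y,uv\}=u\{x,y,v\}+\{x,y,u\}v$. A Poisson 3-Lie $A$-module is an $A$-module $(M,\cdot)$ which is also a 3-Lie $A$-module $(M,\diamond)$ with $(xy,z)\diamond m=x\cdot((y,z)\diamond m)+y\cdot((x,z)\diamond m)$ and $(x,y)\diamond(z\cdot m)=\{x,y,z\}\cdot m+z\cdot((x,y)\diamond m)$. A right $H$-comodule Poisson 3-Lie algebra is a Poisson 3-Lie algebra $A$ that is a right $H$-comodule algebra with $\rho(\{x,y,z\})=\{x_{(0)},y_{(0)},z_{(0)}\}\otimes x_{(1)}y_{(1)}z_{(1)}$. A Poisson 3-Lie $(A,H)$-Hopf module is a Poisson 3-Lie $A$-module $M$ that is an $(A,H)$-Hopf module (a left $A$-module and right $H$-comodule with $\rho(a\cdot m)=a_{(0)}\cdot m_{(0)}\otimes a_{(1)}m_{(1)}$) such that $\rho((x,y)\diamond m)=(x_{(0)},y_{(0)})\diamond m_{(0)}\otimes x_{(1)}y_{(1)}m_{(1)}$. Morphisms are maps that are $A$-linear, 3-Lie $A$-linear ($f((x,y)\diamond m)=(x,y)\diamond f(m)$) and $H$-colinear; the resulting category is ${}_{\mathcal{P}A}\mathcal{M}^H$.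 $A$ itself is an object with $(x,y)\diamond a=\{x,y,a\}$. ${}_B\mathcal{M}$ is the category of $B$-modules. Invariants: $A^A=\{b\in A:\{b,A,A\}=0\}$ (a subalgebra and $H$-subcomodule of $A$), $M^A=\{m\in M:(x,y)\diamond m=0\ \forall x,y\in A\}$, $A^{AcoH}=A^A\cap A^{coH}$, $M^{AcoH}=M^A\cap M^{coH}$ (a $B$-submodule of $M$). A morphism $f:M\to N$ restricts to $M^{AcoH}\to N^{AcoH}$; this defines $G$ on morphisms. Given $\phi$, define, for any Poisson 3-Lie $(A,H)$-Hopf module $M$, the map $p_M:M\to M$, $p_M(m)=\phi(S^{-1}(m_{(1)}))\cdot m_{(0)}$, whose image is $M^{coH}$, and $(x,y)\diamond' m=p_M((x,y)\diamond m)$; in particular, for $M=A$, $(x,y)\diamond' a=p_A(\{x,y,a\})$. Then $(M,\diamond')$ is a 3-Lie $A$-module with $M^{coH}$ as a 3-Lie $A$-submodule. For a functor $G:\mathcal{C}\to\mathcal{D}$, an object $P$ of $\mathcal{C}$ is $G$-relative projective if for every morphism $i:C\to C'$ in $\mathcal{C}$ such that $G(i)$ has a right inverse in $\mathcal{D}$ (is a split epimorphism), and every morphism $f:P\to C'$ in $\mathcal{C}$, there is a morphism $g:P\to C$ in $\mathcal{C}$ with $f=i\circ g$. $G$ is dual Maschke if every object of $\mathcal{C}$ is $G$-relative projective.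
   Formalization: The triviality of M^{coH} under ⋄' is assumed for every Poisson 3-Lie (A,H)-Hopf module M, not for one fixed M; with one fixed M (e.g. M=0, H=k, A=k[x,y] with zero bracket) the dual Maschke claim fails. *)

(* Defs.v *)
From HB Require Import structures.
From mathcomp Require Import all_boot ssralg generic_quotient ring_quotient.
From mathcomp Require Import boolp.
From mathcomp Require Import freeg.

Set Implicit Arguments.
Unset Strict Implicit.
Unset Printing Implicit Defensive.

Import GRing.Theory.

Local Open Scope ring_scope.

Section Bilinear.

Variable k : fieldType.

Definition bilinear_map (U V W : lmodType k) (b : U -> V -> W) : Prop :=
  (forall u, linear (b u)) /\ (forall v, linear (b^~ v)).

Definition trilinear_map (U V W X : lmodType k) (t : U -> V -> W -> X) : Prop :=
  [/\ forall v w, linear (fun u => t u v w),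
      forall u w, linear (fun v => t u v w)
    & forall u v, linear (fun w => t u v w)].

End Bilinear.

(* U (x) V is the free k-module on U * V modulo the submodule spanned by the  *)
(* bilinearity relations.                                                     *)
Section Tensor.

Variables (k : fieldType) (U V : lmodType k).

Local Notation free := {freeg (U * V)%type / k}.

Inductive bilinear_rel : free -> Prop :=
| Rel0 : bilinear_rel 0
| RelB x y : bilinear_rel x -> bilinear_rel y -> bilinear_rel (x - y)
| RelZ c x : bilinear_rel x -> bilinear_rel (c *: x)
| RelDl u u' v :
    bilinear_rel (<< (u + u', v) >> - << (u, v) >> - << (u', v) >>)
| RelDr u v v' :
    bilinear_rel (<< (u, v + v') >> - << (u, v) >> - << (u, v') >>)
| RelZl c u v : bilinear_rel (<< (c *: u, v) >> - c *: << (u, v) >>)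
| RelZr c u v : bilinear_rel (<< (u, c *: v) >> - c *: << (u, v) >>).

Definition bilinear_relb (x : free) : bool := `[< bilinear_rel x >].

Fact bilinear_relb_zmod : zmod_closed bilinear_relb.
Proof.
split; first exact/asboolP/Rel0.
by move=> x y /asboolP hx /asboolP hy; apply/asboolP/RelB.
Qed.

HB.instance Definition _ :=
  GRing.isZmodClosed.Build free bilinear_relb bilinear_relb_zmod.

Definition tensor : Type := 
  @Quotient.quot free (GRing.ZmodClosed.clone free bilinear_relb _).

HB.instance Definition _ := GRing.Zmodule.on tensor.
HB.instance Definition _ := Quotient.on tensor.

Local Notation cls := (\pi_tensor%qT : free -> tensor).

Fact tensor_clsP (x y : free) : (cls x = cls y) <-> bilinear_rel (x - y).
Proof.
split.
  by move/eqP; rewrite -Quotient.idealrBE => /asboolP.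
by move=> h; apply/eqP; rewrite -Quotient.idealrBE; apply/asboolP.
Qed.

Fact tensor_clsD : {morph cls : x y / x + y}.
Proof. by move=> x y; apply: pi_addr. Qed.

Fact tensor_repr_cls (x : free) : bilinear_rel (repr (cls x) - x).
Proof. by apply/tensor_clsP; rewrite reprK. Qed.

Definition tscale (c : k) (t : tensor) : tensor := cls (c *: repr t).

Fact tscale_cls c x : tscale c (cls x) = cls (c *: x).
Proof.
by apply/tensor_clsP; rewrite -scalerBr; apply: RelZ; apply: tensor_repr_cls.
Qed.

Fact tensor_ind (P : tensor -> Prop) : (forall x, P (cls x)) -> forall t, P t.
Proof. by move=> h t; rewrite -[t]reprK. Qed.

Fact tscaleA a b t : tscale a (tscale b t) = tscale (a * b) t.
Proof. by elim/tensor_ind: t => x; rewrite !tscale_cls scalerA. Qed.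

Fact tscale1 : left_id 1 tscale.
Proof. by elim/tensor_ind => x; rewrite tscale_cls scale1r. Qed.

Fact tscaleDr : right_distributive tscale +%R.
Proof.
move=> a; elim/tensor_ind => x; elim/tensor_ind => y.
by rewrite -tensor_clsD !tscale_cls scalerDr tensor_clsD.
Qed.

Fact tscaleDl t : {morph tscale^~ t : a b / a + b}.
Proof.
by elim/tensor_ind: t => x a b; rewrite !tscale_cls scalerDl tensor_clsD.
Qed.

HB.instance Definition _ :=
  GRing.Zmodule_isLmodule.Build k tensor tscaleA tscale1 tscaleDr tscaleDl.

Definition tmul (u : U) (v : V) : tensor := cls << (u, v) >>.

Fact tmul_bilinear : bilinear_map tmul.
Proof.
have piE x y : bilinear_rel (x - y) -> cls x = cls y by move/tensor_clsP.
have Dl u u' v : tmul (u + u') v = tmul u v + tmul u' v.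
  by rewrite /tmul -tensor_clsD; apply: piE; rewrite opprD addrA; apply: RelDl.
have Dr u v v' : tmul u (v + v') = tmul u v + tmul u v'.
  by rewrite /tmul -tensor_clsD; apply: piE; rewrite opprD addrA; apply: RelDr.
have Zl c u v : tmul (c *: u) v = c *: tmul u v.
  by rewrite [RHS]tscale_cls; apply: piE; apply: RelZl.
have Zr c u v : tmul u (c *: v) = c *: tmul u v.
  by rewrite [RHS]tscale_cls; apply: piE; apply: RelZr.
by split=> [u c v v'|v c u u']; rewrite ?Dl ?Dr ?Zl ?Zr.
Qed.

End Tensor.

Notation "U '(x)' V" := (tensor U V)
  (at level 40, left associativity) : type_scope.
Notation "u '(x)' v" := (tmul u v)
  (at level 40, left associativity) : ring_scope.

(* Sweedler's notation: [tlift t b] is \sum b(t_1, t_2) for t = \sum t_1 (x)  *)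
(* t_2.  It uses an arbitrary representative of t, hence is meaningful only   *)
(* for bilinear b, see [tlift_tmul] and [tlift_linear].                       *)
Section Lift.

Variables (k : fieldType) (U V W : lmodType k).
Implicit Type b : U -> V -> W.

Definition flift b : {freeg (U * V)%type / k} -> W :=
  fglift (fun p => b p.1 p.2).

Definition tlift (t : U (x) V) b : W := flift b (repr t).

Fact flift_linear b : linear (flift b).
Proof.
have B x y : flift b (x - y) = flift b x - flift b y.
  exact: lift_is_additive.
have flift0 : flift b 0 = 0 by rewrite -[X in flift _ X](subrr 0) B subrr.
have D x y : flift b (x + y) = flift b x + flift b y.
  by rewrite -[y in LHS]opprK B -[- y]sub0r B flift0 sub0r opprK.
have S (I : Type) (r : seq I) F :
    flift b (\sum_(i <- r) F i) = \sum_(i <- r) flift b (F i).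
  exact: (big_morph (flift b) D flift0).
move=> c x y; rewrite D; congr (_ + _).
rewrite -[x in RHS]freeg_sumE [c *: x]/(fgscale c x) /fgscale !S scaler_sumr.
by apply: eq_bigr => z _; rewrite /flift !liftU scalerA.
Qed.

Fact flift1 b u v : flift b << (u, v) >> = b u v.
Proof. by rewrite /flift liftU scale1r. Qed.

Fact linear_props (X Y : lmodType k) (f : X -> Y) : linear f ->
  [/\ f 0 = 0, {morph f : x y / x + y}, {morph f : x y / x - y}
    & scalable f].
Proof.
move=> lf; have B : {morph f : x y / x - y} by exact: zmod_morphism_linear.
have Z : scalable f by exact: scalable_linear.
have f0 : f 0 = 0 by rewrite -[X in f X](subrr 0) B subrr.
by split=> // x y; have := lf 1 x y; rewrite !scale1r.
Qed.

Fact flift_rel b x : bilinear_map b -> bilinear_rel x -> flift b x = 0.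
Proof.
move=> [bl br]; have [f0 fD fB fZ] := linear_props (flift_linear b).
elim=> {x} [|x y _ hx _ hy|c x _ hx|u u' v|u v v'|c u v|c u v].
- exact: f0.
- by rewrite fB hx hy subrr.
- by rewrite fZ hx scaler0.
- have [_ bD _ _] := linear_props (br v).
  by rewrite !fB !flift1 bD addrAC addrK subrr.
- have [_ bD _ _] := linear_props (bl u).
  by rewrite !fB !flift1 bD addrAC addrK subrr.
- by have [_ _ _ bZ] := linear_props (br v); rewrite fB fZ !flift1 bZ subrr.
by have [_ _ _ bZ] := linear_props (bl u); rewrite fB fZ !flift1 bZ subrr.
Qed.

Lemma tlift_cls b x : bilinear_map b -> tlift (\pi%qT x) b = flift b x.
Proof.
move=> hb; have [_ _ fB _] := linear_props (flift_linear b).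
by apply/eqP; rewrite -subr_eq0 -fB flift_rel //; apply: tensor_repr_cls.
Qed.

Lemma tlift_tmul b u v : bilinear_map b -> tlift (u (x) v) b = b u v.
Proof. by move=> hb; rewrite tlift_cls // flift1. Qed.

Lemma tlift_linear b : bilinear_map b -> linear (tlift^~ b).
Proof.
move=> hb c; elim/tensor_ind => x; elim/tensor_ind => y.
by rewrite [c *: _]tscale_cls -tensor_clsD !tlift_cls // flift_linear.
Qed.

End Lift.

Lemma tlift_linear_fun (k : fieldType) (U V W X : lmodType k)
    (b : X -> U -> V -> W) (t : U (x) V) :
  (forall u v, linear (fun x => b x u v)) -> linear (fun x => tlift t (b x)).
Proof.
move=> hb c x y; rewrite /tlift; elim/quotW: (repr t) => D.
rewrite /flift !piE /lift /prelift scaler_sumr -big_split.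
by apply: eq_bigr => i _; rewrite hb /= scalerDr !scalerA mulrC.
Qed.

Lemma linear_tlift (k : fieldType) (U V W X : lmodType k) (f : W -> X)
    (b : U -> V -> W) (t : U (x) V) :
  linear f -> f (tlift t b) = tlift t (fun u v => f (b u v)).
Proof.
move=> /linear_props[f0 fD _ fZ]; rewrite /tlift; elim/quotW: (repr t) => D.
rewrite /flift !piE /lift /prelift (big_morph f fD f0).
by apply: eq_bigr => i _; rewrite fZ.
Qed.

Lemma tlift_id (k : fieldType) (U V : lmodType k) (t : U (x) V) :
  tlift t (fun u v => u (x) v) = t.
Proof.
have [f0 fD _ fZ] := linear_props (flift_linear (@tmul k U V)).
rewrite -[RHS]reprK /tlift; set x := repr t.
have Z c y : \pi_(U (x) V)%qT (c *: y) = c *: \pi_(U (x) V)%qT y.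
  by rewrite [RHS]tscale_cls.
have Zr c y : c *: (<< y >> : {freeg (U * V)%type / k}) = << c *g y >>.
  by apply/eqP/freeg_eqP => z; rewrite coeffZ !coeffU mul1r.
rewrite -[x]freeg_sumE (big_morph _ fD f0).
have pi0 : \pi_(U (x) V)%qT 0 = 0.
  by apply: (addrI (\pi_(U (x) V)%qT 0)); rewrite -tensor_clsD !addr0.
rewrite (big_morph \pi_(U (x) V)%qT (@tensor_clsD _ _ _) pi0).
apply: eq_bigr => -[u v] _; rewrite -Zr Z fZ; congr (_ *: _).
exact: flift1.
Qed.

Record hopfAlgebra (k : fieldType) := HopfAlgebra {
  hopf_alg :> algType k;
  comul : hopf_alg -> hopf_alg (x) hopf_alg;
  counit : hopf_alg -> k;
  antipode : hopf_alg -> hopf_alg;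
  comul_linear : linear comul;
  counit_linear : linear (counit : hopf_alg -> k^o);
  antipode_linear : linear antipode;
  comul_coassoc : forall h,
    tlift (comul h) (fun h1 h2 =>
      tlift (comul h1) (fun h11 h12 => h11 (x) (h12 (x) h2)))
    = tlift (comul h) (fun h1 h2 => h1 (x) comul h2);
  comul_counitl : forall h,
    tlift (comul h) (fun h1 h2 => counit h1 *: h2) = h;
  comul_counitr : forall h,
    tlift (comul h) (fun h1 h2 => counit h2 *: h1) = h;
  comul1 : comul 1 = 1 (x) 1;
  comulM : forall h g,
    comul (h * g)
    = tlift (comul h) (fun h1 h2 => tlift (comul g) (fun g1 g2 =>
        (h1 * g1) (x) (h2 * g2)));
  counit1 : counit 1 = 1;
  counitM : {morph counit : h g / h * g};
  antipodel : forall h,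
    tlift (comul h) (fun h1 h2 => antipode h1 * h2) = (counit h)%:A;
  antipoder : forall h,
    tlift (comul h) (fun h1 h2 => h1 * antipode h2) = (counit h)%:A
}.

(* Commutative k-algebras, the zero algebra included (which comAlgType       *)
(* excludes): a commutative ring with a ring morphism from k.                 *)
Record comAlgebra (k : fieldType) := ComAlgebra {
  comAlgebra_ring : comPzRingType;
  of_scalar : {rmorphism k -> comAlgebra_ring}
}.

Definition comAlgebra_sort (k : fieldType) (A : comAlgebra k) : Type :=
  comAlgebra_ring A.
Coercion comAlgebra_sort : comAlgebra >-> Sortclass.

Section ComAlgebraLmodule.

Variables (k : fieldType) (A : comAlgebra k).

HB.instance Definition _ := GRing.ComPzRing.on (comAlgebra_sort A).

Definition alg_scale (c : k) (a : A) : A := of_scalar A c * a.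

Fact alg_scaleA c d a : alg_scale c (alg_scale d a) = alg_scale (c * d) a.
Proof. by rewrite /alg_scale rmorphM mulrA. Qed.

Fact alg_scale1 : left_id 1 alg_scale.
Proof. by move=> a; rewrite /alg_scale rmorph1 mul1r. Qed.

Fact alg_scaleDr : right_distributive alg_scale +%R.
Proof. by move=> c a b; rewrite /alg_scale mulrDr. Qed.

Fact alg_scaleDl a : {morph alg_scale^~ a : c d / c + d}.
Proof. by move=> c d; rewrite /alg_scale rmorphD mulrDl. Qed.

HB.instance Definition _ :=
  GRing.Zmodule_isLmodule.Build k (comAlgebra_sort A)
    alg_scaleA alg_scale1 alg_scaleDr alg_scaleDl.

Fact alg_scaleAl c (a b : A) : c *: (a * b) = (c *: a) * b.
Proof. exact: mulrA. Qed.

Fact alg_scaleAr c (a b : A) : c *: (a * b) = a * (c *: b).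
Proof. exact: mulrCA. Qed.

Fact alg_mul_bilinear : bilinear_map ( *%R : A -> A -> A).
Proof.
split=> [a c b b'|b c a a'].
  by rewrite mulrDr alg_scaleAr.
by rewrite mulrDl alg_scaleAl.
Qed.

End ComAlgebraLmodule.

Record is_3Lie (k : fieldType) (A : lmodType k) (br : A -> A -> A -> A) : Prop := {
  br_trilinear : trilinear_map br;
  br_skew12 : forall x y z, br x y z = - br y x z;
  br_skew23 : forall x y z, br x y z = - br x z y;
  br_jacobi : forall x y z u v,
    br (br x y z) u v
    = br (br x u v) y z + br (br y u v) z x + br (br z u v) x y
}.

Record is_3Lie_module (k : fieldType) (A M : lmodType k)
    (br : A -> A -> A -> A) (dia : A -> A -> M -> M) : Prop := {
  dia_trilinear : trilinear_map dia;
  dia_skew : forall x y m, dia x y m = - dia y x m;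
  dia_comm : forall x y u v m,
    dia x y (dia u v m) - dia u v (dia x y m)
    = dia (br x y u) v m + dia u (br x y v) m;
  dia_br : forall x y u v m,
    dia (br x y u) v m
    = dia y u (dia x v m) - dia x u (dia y v m) + dia x y (dia u v m)
}.

Record poisson3Lie (k : fieldType) := Poisson3Lie {
  poisson_alg :> comAlgebra k;
  bracket : poisson_alg -> poisson_alg -> poisson_alg -> poisson_alg;
  bracket_3Lie : is_3Lie bracket;
  bracket_leibniz : forall x y u v,
    bracket x y (u * v) = u * bracket x y v + bracket x y u * v
}.

Record is_module (k : fieldType) (A : comAlgebra k) (M : lmodType k)
    (act : A -> M -> M) : Prop := {
  act_bilinear : bilinear_map act;
  act1 : forall m, act 1 m = m;
  actM : forall a b m, act (a * b) m = act a (act b m)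
}.

Record is_poisson3Lie_module (k : fieldType) (A : poisson3Lie k)
    (M : lmodType k) (act : A -> M -> M) (dia : A -> A -> M -> M) : Prop := {
  poisson_is_module : is_module act;
  poisson_is_3Lie_module : is_3Lie_module (@bracket _ A) dia;
  dia_mull : forall x y z m,
    dia (x * y) z m = act x (dia y z m) + act y (dia x z m);
  dia_act : forall x y z m,
    dia x y (act z m) = act (bracket x y z) m + act z (dia x y m)
}.

Record is_comodule (k : fieldType) (H : hopfAlgebra k) (M : lmodType k)
    (rho : M -> M (x) H) : Prop := {
  coact_linear : linear rho;
  coact_coassoc : forall m,
    tlift (rho m) (fun m0 m1 =>
      tlift (rho m0) (fun m00 m01 => m00 (x) (m01 (x) m1)))
    = tlift (rho m) (fun m0 m1 => m0 (x) comul m1);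
  coact_counit : forall m,
    tlift (rho m) (fun m0 m1 => counit m1 *: m0) = m
}.

Record comodPoisson3Lie (k : fieldType) (H : hopfAlgebra k) := ComodPoisson3Lie {
  comod_poisson :> poisson3Lie k;
  coactA : comod_poisson -> comod_poisson (x) H;
  coactA_comodule : is_comodule coactA;
  coactA1 : coactA 1 = (1 : comod_poisson) (x) (1 : H);
  coactAM : forall a b,
    coactA (a * b)
    = tlift (coactA a) (fun a0 a1 => tlift (coactA b) (fun b0 b1 =>
        (a0 * b0) (x) (a1 * b1)));
  coactA_bracket : forall x y z,
    coactA (bracket x y z)
    = tlift (coactA x) (fun x0 x1 => tlift (coactA y) (fun y0 y1 =>
      tlift (coactA z) (fun z0 z1 =>
        bracket x0 y0 z0 (x) (x1 * y1 * z1))))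
}.

Record hopfModule (k : fieldType) (H : hopfAlgebra k) (A : comodPoisson3Lie H) :=
  HopfModule {
  hopf_mod :> lmodType k;
  act : A -> hopf_mod -> hopf_mod;
  dia : A -> A -> hopf_mod -> hopf_mod;
  coact : hopf_mod -> hopf_mod (x) H;
  hopf_mod_poisson : is_poisson3Lie_module act dia;
  hopf_mod_comodule : is_comodule coact;
  coact_act : forall a m,
    coact (act a m)
    = tlift (coactA a) (fun a0 a1 => tlift (coact m) (fun m0 m1 =>
        act a0 m0 (x) (a1 * m1)));
  coact_dia : forall x y m,
    coact (dia x y m)
    = tlift (coactA x) (fun x0 x1 => tlift (coactA y) (fun y0 y1 =>
      tlift (coact m) (fun m0 m1 =>
        dia x0 y0 m0 (x) (x1 * y1 * m1))))
}.

Record hopfModuleHom (k : fieldType) (H : hopfAlgebra k) (A : comodPoisson3Lie H)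
    (M N : hopfModule A) := HopfModuleHom {
  hom_fun :> {linear M -> N};
  hom_act : forall a m, hom_fun (act a m) = act a (hom_fun m);
  hom_dia : forall x y m, hom_fun (dia x y m) = dia x y (hom_fun m);
  hom_coact : forall m,
    coact (hom_fun m) = tlift (coact m) (fun m0 m1 => hom_fun m0 (x) m1)
}.

Section RegularModule.

Variables (k : fieldType) (H : hopfAlgebra k) (A : comodPoisson3Lie H).

Fact regular_3Lie_module :
  is_3Lie_module (@bracket _ A) (@bracket _ A : A -> A -> A -> A).
Proof.
have [tri s12 s23 jac] := bracket_3Lie A.
have rot x y z : bracket x y z = bracket (z : A) x y.
  by rewrite s23 s12 opprK.
split=> // [x y u v m|x y u v m].
  rewrite (rot x y (bracket u v m)) jac -(rot x y u) -(rot x y v) -(rot x y m).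
  by rewrite (rot u v (bracket x y m)) (rot (bracket x y v) m u) addrK.
rewrite jac (rot y u) (rot x u) (rot x y (bracket u v m)).
by rewrite (s23 (bracket y v m) u x).
Qed.

Fact regular_poisson_module :
  is_poisson3Lie_module ( *%R : A -> A -> A) (@bracket _ A).
Proof.
have [tri s12 s23 jac] := bracket_3Lie A.
have rot x y z : bracket x y z = bracket (z : A) x y.
  by rewrite s23 s12 opprK.
split=> [||x y z m|x y z m].
- split=> [|a|a b m]; first exact: alg_mul_bilinear.
    exact: mul1r.
  by rewrite mulrA.
- exact: regular_3Lie_module.
- by rewrite -rot bracket_leibniz (rot z m y) (rot z m x) (mulrC _ y).
by rewrite bracket_leibniz addrC.
Qed.

Definition regularModule : hopfModule A :=
  HopfModule regular_poisson_module (coactA_comodule A)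
    (@coactAM _ _ A) (@coactA_bracket _ _ A).

End RegularModule.

Section Invariants.

Variables (k : fieldType) (H : hopfAlgebra k) (A : comodPoisson3Lie H).

(* A^A *)
Definition poisson_center (b : A) : bool :=
  `[< forall x y : A, bracket b x y = 0 >].

(* M^{coH} *)
Definition coinv (M : hopfModule A) (m : M) : bool :=
  `[< coact m = m (x) (1 : H) >].

(* M^{AcoH} *)
Definition inv_coinv (M : hopfModule A) (m : M) : bool :=
  `[< forall x y : A, dia x y m = 0 >] && coinv m.

(* A^{AcoH} *)
Definition inv_coinvA (b : A) : bool :=
  poisson_center b && `[< coactA b = b (x) (1 : H) >].


Fact tlift2_tmul (U V W : lmodType k) (f : U -> V -> W) u v (h g : H) :
  bilinear_map f ->
  tlift (u (x) h) (fun u0 u1 => tlift (v (x) g) (fun v0 v1 =>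
    f u0 v0 (x) (u1 * v1)))
  = f u v (x) (h * g).
Proof.
move=> [fl fr]; have tl a := (tmul_bilinear _ _).1 a.
have tr a := (tmul_bilinear _ _).2 a.
have b1 u0 (u1 : H) : bilinear_map (fun v0 v1 => f u0 v0 (x) (u1 * v1)).
  split=> [v0 c x y|v1 c x y]; last by rewrite fl tr.
  by rewrite mulrDr -scalerAr tl.
rewrite tlift_tmul ?tlift_tmul //; split=> [u0|u1]; apply: tlift_linear_fun.
  by move=> v0 v1 c x y; rewrite mulrDl -scalerAl tl.
by move=> v0 v1 c x y; rewrite fr tr.
Qed.

Fact inv_coinvA_subring : subring_closed inv_coinvA.
Proof.
have [[t1 _ t3] s12 s23 _] := bracket_3Lie A.
have rot x y z : bracket x y z = bracket (z : A) x y by rewrite s23 s12 opprK.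
have [rho_lin _ _] := coactA_comodule A.
have [_ _ rhoB _] := linear_props rho_lin.
have [_ tr] := tmul_bilinear A (H : lmodType k).
have invP b : reflect ((forall x y : A, bracket b x y = 0)
    /\ coactA b = b (x) (1 : H)) (b \in inv_coinvA).
  by apply: (iffP andP) => -[/asboolP h1 /asboolP h2]; split=> //; apply/asboolP.
split.
- apply/invP; split=> [x y|]; last exact: coactA1.
  rewrite -rot; have := bracket_leibniz x y 1 1; rewrite !mul1r mulr1 => /eqP.
  by rewrite -subr_eq0 opprD addrA subrr sub0r oppr_eq0 => /eqP.
- move=> a b /invP[a0 a1] /invP[b0 b1]; apply/invP; split=> [x y|].
    have [_ _ B _] := linear_props (t1 x y).
    by rewrite B a0 b0 subrr.
  have [_ _ B _] := linear_props (tr (1 : H)).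
  by rewrite rhoB a1 b1 B.
move=> a b /invP[a0 a1] /invP[b0 b1]; apply/invP; split=> [x y|].
  by rewrite -rot bracket_leibniz (rot x y a) (rot x y b) a0 b0 mulr0 mul0r addr0.
by rewrite coactAM a1 b1 (tlift2_tmul _ _ _ _ (alg_mul_bilinear A)) mulr1.
Qed.

(* The ring B = A^{AcoH} *)
Definition invRing : Type := {b : A | inv_coinvA b}.

HB.instance Definition _ := SubChoice.on invRing.
HB.instance Definition _ :=
  GRing.SubChoice_isSubComPzRing.Build A inv_coinvA invRing inv_coinvA_subring.

Variable M : hopfModule A.

Fact inv_coinv_zmod : zmod_closed (@inv_coinv M).
Proof.
have [[_ _ t3] _ _ _] := poisson_is_3Lie_module (hopf_mod_poisson M).
have [rho_lin _ _] := hopf_mod_comodule M.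
have [rho0 _ rhoB _] := linear_props rho_lin.
have [_ tr] := tmul_bilinear M (H : lmodType k).
have [tm0 _ tmB _] := linear_props (tr (1 : H)).
have invP m : reflect ((forall x y : A, dia x y m = 0)
    /\ coact m = m (x) (1 : H)) (m \in @inv_coinv M).
  by apply: (iffP andP) => -[/asboolP h1 /asboolP h2]; split=> //; apply/asboolP.
split=> [|m n /invP[m0 m1] /invP[n0 n1]]; apply/invP; split=> [x y|].
- by have [] := linear_props (t3 x y).
- by rewrite rho0 tm0.
- by have [_ _ B _] := linear_props (t3 x y); rewrite B m0 n0 subrr.
by rewrite rhoB m1 n1 tmB.
Qed.

(* M^{AcoH} as a B-module *)
Definition invMod : Type := {m : M | inv_coinv m}.

HB.instance Definition _ := SubChoice.on invMod.
HB.instance Definition _ :=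
  GRing.SubChoice_isSubZmodule.Build M (@inv_coinv M) invMod inv_coinv_zmod.

Fact inv_coinv_act (b : A) (m : M) :
  inv_coinvA b -> inv_coinv m -> inv_coinv (act b m).
Proof.
have [_ s12 s23 _] := bracket_3Lie A.
have [[[al ar] _ _] _ _ da] := hopf_mod_poisson M.
move=> /andP[/asboolP b0 /asboolP b1] /andP[/asboolP m0 /asboolP m1].
apply/andP; split; apply/asboolP.
  move=> x y; rewrite da m0 s23 s12 opprK b0.
  have [-> _ _ _] := linear_props (ar m); have [-> _ _ _] := linear_props (al b).
  exact: addr0.
by rewrite coact_act b1 m1 (tlift2_tmul _ _ _ _ (conj al ar)) mulr1.
Qed.

Definition invMod_scale (b : invRing) (m : invMod) : invMod :=
  exist _ (act (val b) (val m)) (inv_coinv_act (valP b) (valP m)).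

Fact invMod_scaleA a b m :
  invMod_scale a (invMod_scale b m) = invMod_scale (a * b) m.
Proof.
have [[_ _ aM] _ _ _] := hopf_mod_poisson M.
by apply: val_inj; rewrite /= aM.
Qed.

Fact invMod_scale1 : left_id 1 invMod_scale.
Proof.
have [[_ a1 _] _ _ _] := hopf_mod_poisson M.
by move=> m; apply: val_inj; rewrite /= a1.
Qed.

Fact invMod_scaleDr : right_distributive invMod_scale +%R.
Proof.
have [[[al ar] _ _] _ _ _] := hopf_mod_poisson M.
move=> b m n; apply: val_inj; rewrite /=.
by have [_ D _ _] := linear_props (al (val b)); rewrite D.
Qed.

Fact invMod_scaleDl m : {morph invMod_scale^~ m : a b / a + b}.
Proof.
have [[[al ar] _ _] _ _ _] := hopf_mod_poisson M.
move=> a b; apply: val_inj; rewrite /=.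
by have [_ D _ _] := linear_props (ar (val m)); rewrite D.
Qed.

HB.instance Definition _ :=
  GRing.Zmodule_isLmodule.Build invRing invMod
    invMod_scaleA invMod_scale1 invMod_scaleDr invMod_scaleDl.

End Invariants.

(* The projection m |-> phi(S^-1(m_(1))) . m_(0) onto M^{coH}, for psi = S^-1. *)
Definition coinv_proj (k : fieldType) (H : hopfAlgebra k) (A : comodPoisson3Lie H)
    (phi : H -> A) (psi : H -> H) (M : hopfModule A) (m : M) : M :=
  tlift (coact m) (fun m0 m1 => act (phi (psi m1)) m0).

Definition dia_proj (k : fieldType) (H : hopfAlgebra k) (A : comodPoisson3Lie H)
    (phi : H -> A) (psi : H -> H) (M : hopfModule A) (x y : A) (m : M) : M :=
  coinv_proj phi psi (dia x y m).

Definition coinv_trivial (k : fieldType) (H : hopfAlgebra k)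
    (A : comodPoisson3Lie H) (phi : H -> A) (psi : H -> H) (M : hopfModule A) :
    Prop :=
  forall (x y : A) (m : M), coinv m -> dia_proj phi psi x y m = 0.

Record category := Category {
  obj :> Type;
  hom : obj -> obj -> Type;
  idc : forall X, hom X X;
  comp : forall X Y Z, hom Y Z -> hom X Y -> hom X Z;
  comp_idl : forall X Y (f : hom X Y), comp (idc Y) f = f;
  comp_idr : forall X Y (f : hom X Y), comp f (idc X) = f;
  comp_assoc : forall X Y Z T (f : hom Z T) (g : hom Y Z) (h : hom X Y),
    comp f (comp g h) = comp (comp f g) h
}.

Record functor (C D : category) := Functor {
  fobj :> C -> D;
  fmap : forall X Y, hom X Y -> hom (fobj X) (fobj Y);
  fmap_id : forall X, fmap (idc X) = idc (fobj X);
  fmap_comp : forall X Y Z (f : hom Y Z) (g : hom X Y),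
    fmap (comp f g) = comp (fmap f) (fmap g)
}.

Section RelativeProjective.

Variables (C D : category) (G : functor C D).

Definition split_epi (X Y : D) (f : hom X Y) : Prop :=
  exists s : hom Y X, comp f s = idc Y.

Definition relative_projective (P : C) : Prop :=
  forall (X Y : C) (i : hom X Y), split_epi (fmap G i) ->
  forall f : hom P Y, exists g : hom P X, f = comp i g.

Definition dual_maschke : Prop := forall P : C, relative_projective P.

End RelativeProjective.

Fact linear_ext (R : pzRingType) (M N : lmodType R) (f g : {linear M -> N}) :
  f =1 g -> f = g.
Proof.
case: f => f [[f1] [f2]]; case: g => g [[g1] [g2]] /= /funext fg.
case: _ / fg g1 g2 => g1 g2; rewrite (Prop_irrelevance f1 g1).
by rewrite (Prop_irrelevance f2 g2).
Qed.

Section ModuleCat.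

Variable R : pzRingType.

Let mhom (M N : lmodType R) : Type := {linear M -> N}.
Let mid (M : lmodType R) : mhom M M := idfun.
Let mcomp (L M N : lmodType R) (f : mhom M N) (g : mhom L M) : mhom L N :=
  f \o g.

Fact mcomp_idl M N (f : mhom M N) : mcomp (mid N) f = f.
Proof. exact: linear_ext. Qed.

Fact mcomp_idr M N (f : mhom M N) : mcomp f (mid M) = f.
Proof. exact: linear_ext. Qed.

Fact mcompA K L M N (f : mhom M N) (g : mhom L M) (h : mhom K L) :
  mcomp f (mcomp g h) = mcomp (mcomp f g) h.
Proof. exact: linear_ext. Qed.

Definition moduleCat : category := Category mcomp_idl mcomp_idr mcompA.

End ModuleCat.

Section HopfModuleCat.

Variables (k : fieldType) (H : hopfAlgebra k) (A : comodPoisson3Lie H).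

Fact hopf_hom_ext (M N : hopfModule A) (f g : hopfModuleHom M N) :
  f =1 g -> f = g.
Proof.
case: f => f f1 f2 f3; case: g => g g1 g2 g3 /= /linear_ext fg.
case: _ / fg g1 g2 g3 => g1 g2 g3.
rewrite (Prop_irrelevance f1 g1) (Prop_irrelevance f2 g2).
by rewrite (Prop_irrelevance f3 g3).
Qed.

Fact tmul_comp_bilinear (M N : lmodType k) (f : {linear M -> N}) :
  bilinear_map (fun (m : M) (h : H) => f m (x) h).
Proof.
have [tl tr] := tmul_bilinear N (H : lmodType k).
by split=> [m c x y|h c x y]; rewrite ?tl // linearP tr.
Qed.

Fact hopf_id_coact (M : hopfModule A) (m : M) :
  coact m = tlift (coact m) (fun m0 m1 => m0 (x) m1).
Proof. by rewrite tlift_id. Qed.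

Definition hopf_id (M : hopfModule A) : hopfModuleHom M M :=
  @HopfModuleHom _ _ _ M M idfun
    (fun _ _ => erefl) (fun _ _ _ => erefl) (@hopf_id_coact M).

Section Comp.

Variables (L M N : hopfModule A) (f : hopfModuleHom M N) (g : hopfModuleHom L M).

Fact hopf_comp_act a m : f (g (act a m)) = act a (f (g m)).
Proof. by rewrite !hom_act. Qed.

Fact hopf_comp_dia x y m : f (g (dia x y m)) = dia x y (f (g m)).
Proof. by rewrite !hom_dia. Qed.

Fact hopf_comp_coact m :
  coact (f (g m)) = tlift (coact m) (fun m0 m1 => f (g m0) (x) m1).
Proof.
rewrite !hom_coact.
rewrite (linear_tlift _ _ (tlift_linear (tmul_comp_bilinear f))).
by congr tlift; apply/funext => u; apply/funext => v;
  rewrite (tlift_tmul _ _ (tmul_comp_bilinear f)).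
Qed.

Definition hopf_comp : hopfModuleHom L N :=
  @HopfModuleHom _ _ _ L N (f \o g)
    hopf_comp_act hopf_comp_dia hopf_comp_coact.

End Comp.

Fact hopf_comp_idl (M N : hopfModule A) (f : hopfModuleHom M N) :
  hopf_comp (hopf_id N) f = f.
Proof. exact: hopf_hom_ext. Qed.

Fact hopf_comp_idr (M N : hopfModule A) (f : hopfModuleHom M N) :
  hopf_comp f (hopf_id M) = f.
Proof. exact: hopf_hom_ext. Qed.

Fact hopf_compA (K L M N : hopfModule A) (f : hopfModuleHom M N)
    (g : hopfModuleHom L M) (h : hopfModuleHom K L) :
  hopf_comp f (hopf_comp g h) = hopf_comp (hopf_comp f g) h.
Proof. exact: hopf_hom_ext. Qed.

Definition hopfModuleCat : category :=
  Category hopf_comp_idl hopf_comp_idr hopf_compA.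

Section InvariantHom.

Variables (M N : hopfModule A) (f : hopfModuleHom M N).

Fact inv_coinv_hom (m : M) : inv_coinv m -> inv_coinv (f m).
Proof.
move=> /andP[/asboolP m0 /asboolP m1]; apply/andP; split; apply/asboolP.
  by move=> x y; rewrite -hom_dia m0 linear0.
by rewrite hom_coact m1 (tlift_tmul _ _ (tmul_comp_bilinear f)).
Qed.

Definition inv_hom_fun (m : invMod M) : invMod N :=
  exist _ (f (val m)) (inv_coinv_hom (valP m)).

Fact inv_hom_linear : linear inv_hom_fun.
Proof.
move=> b m n; apply: val_inj.
by rewrite /= linearD; congr (_ + _); rewrite /= hom_act.
Qed.

HB.instance Definition _ :=
  GRing.isLinear.Build (invRing A) (invMod M) (invMod N) _ inv_hom_fun
    inv_hom_linear.

Definition inv_hom : {linear invMod M -> invMod N} := inv_hom_fun.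

End InvariantHom.

Fact inv_hom_id (M : hopfModule A) :
  inv_hom (hopf_id M) = @idc (moduleCat (invRing A)) (invMod M).
Proof. by apply: linear_ext => m; apply: val_inj. Qed.

Fact inv_hom_comp (L M N : hopfModule A) (f : hopfModuleHom M N)
    (g : hopfModuleHom L M) :
  inv_hom (hopf_comp f g)
  = @comp (moduleCat (invRing A)) _ _ _ (inv_hom f) (inv_hom g).
Proof. by apply: linear_ext => m; apply: val_inj. Qed.

(* G = (-)^{AcoH} *)
Definition invFunctor : functor hopfModuleCat (moduleCat (invRing A)) :=
  @Functor hopfModuleCat (moduleCat (invRing A)) (fun M => invMod M)
    inv_hom inv_hom_id inv_hom_comp.

End HopfModuleCat.

(* Main.v *)
From HB Require Import structures.
Require Import Defs.
From mathcomp Require Import all_boot ssralg generic_quotient boolp freeg.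

(* Write p for the projection of an object M onto M^{coH}.  Every m in M      *)
(* equals phi(m_1) . p(m_0), and p(phi(h) . n) = eps(h) n for n coinvariant.  *)
(* For n in M^{coH}, (x, y) <> n has coaction (x_0, y_0) <> n (x) x_1 y_1, so *)
(* the first formula writes it as a combination of the elements               *)
(* p((x_0, y_0) <> n), which vanish by hypothesis; since phi takes values in  *)
(* A^A, all the 3-Lie actions (and the bracket of A) are then zero and        *)
(* M^{coH} = M^{AcoH}.                                                        *)
(* If i : X -> Y and s is a B-linear section of G(i), it follows that         *)
(* m |-> phi(m_1) . s(p(m_0)) is a morphism Y -> X and a section of i, so     *)
(* morphisms to Y lift along i by composition with it.                        *)

Set Implicit Arguments.
Unset Strict Implicit.
Unset Printing Implicit Defensive.

Import GRing.Theory.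

Local Open Scope ring_scope.

(** Through [phi] every object is an [H]-Hopf module and, as in the fundamental theorem of Hopf
    modules, is generated over phi(H) by its coinvariants ([coinv_proj_decomp], [coinv_proj_coinv]),
    while [coinv_proj_act] recovers eps(h) n from phi(h) . n. [dia_coinv] and [dia_eq0] turn
    triviality of the projected action into vanishing of the original one, so that M^{coH} =
    M^{AcoH} and A^{coH} = B. A B-linear section s of G(i) is therefore defined on all coinvariants,
    and extends to Y -> X by phi(h) . n |-> phi(h) . s(n) ([coinv_lift]). It is A-linear
    ([coinv_lift_act]) because A is commutative and generated by phi(H) and B; [coinv_liftK] makes
    it a section of i. *)

(** One list serves all [W] and [b], so identities between [tlift]s reduce to finite sums, even for
    [b] not bilinear. *)
Lemma tlift_sum (k : fieldType) (U V : lmodType k) (t : U (x) V) :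
  exists s : seq (k * (U * V)), forall (W : lmodType k) (b : U -> V -> W),
  tlift t b = \sum_(i <- s) i.1 *: b i.2.1 i.2.2.
Proof.
rewrite /tlift; elim/quotW: (repr t) => D.
by exists D => W b; rewrite /flift !piE /lift /prelift.
Qed.

(** * Linearity of Sweedler expressions *)

Section Linear.

Variable k : fieldType.
Implicit Types (U V W X : lmodType k).

Lemma lin_comp U V W (f : V -> W) (g : U -> V) :
  linear f -> linear g -> linear (fun x => f (g x)).
Proof. by move=> lf lg c x y; rewrite lg lf. Qed.

Lemma lin_id U : linear (fun x : U => x).
Proof. by []. Qed.

Lemma lin_tlift U V W X (t : X -> U (x) V) (b : U -> V -> W) :
  linear t -> bilinear_map b -> linear (fun x => tlift (t x) b).
Proof. by move=> lt lb; apply: (lin_comp (tlift_linear lb)). Qed.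

Lemma lin_tmull U V X (g : X -> U) (v : V) :
  linear g -> linear (fun x => g x (x) v).
Proof. exact: (lin_comp ((tmul_bilinear U V).2 v)). Qed.

Lemma lin_tmulr U V X (u : U) (g : X -> V) :
  linear g -> linear (fun x => u (x) g x).
Proof. exact: (lin_comp ((tmul_bilinear U V).1 u)). Qed.

Lemma lin_scaler U X (c : k) (g : X -> U) :
  linear g -> linear (fun x => c *: g x).
Proof. by move=> lg d x y; rewrite lg scalerDr !scalerA mulrC. Qed.

Lemma lin_mull (R : algType k) X (g : X -> R) (r : R) :
  linear g -> linear (fun x => g x * r).
Proof. by move=> lg c x y; rewrite lg mulrDl scalerAl. Qed.

Lemma lin_mulr (R : algType k) X (r : R) (g : X -> R) :
  linear g -> linear (fun x => r * g x).
Proof. by move=> lg c x y; rewrite lg mulrDr scalerAr. Qed.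

Variable H : hopfAlgebra k.

Lemma lin_comul X (g : X -> H) : linear g -> linear (fun x => comul (g x)).
Proof. exact: (lin_comp (@comul_linear k H)). Qed.

Lemma lin_antipode X (g : X -> H) :
  linear g -> linear (fun x => antipode (g x)).
Proof. exact: (lin_comp (@antipode_linear k H)). Qed.

Variables (A : comodPoisson3Lie H) (M : hopfModule A).

Lemma lin_coact X (g : X -> M) : linear g -> linear (fun x => coact (g x)).
Proof. exact: (lin_comp (coact_linear (hopf_mod_comodule M))). Qed.

Lemma lin_actl X (g : X -> A) (m : M) :
  linear g -> linear (fun x => act (g x) m).
Proof.
exact: (lin_comp ((act_bilinear (poisson_is_module (hopf_mod_poisson M))).2 m)).
Qed.

Lemma lin_actr X a (g : X -> M) : linear g -> linear (fun x => act a (g x)).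
Proof.
exact: (lin_comp ((act_bilinear (poisson_is_module (hopf_mod_poisson M))).1 a)).
Qed.

Lemma lin_diar X (g : X -> M) x y : linear g -> linear (fun z => dia x y (g z)).
Proof.
have [_ _ h] := dia_trilinear (poisson_is_3Lie_module (hopf_mod_poisson M)).
exact: (lin_comp (h x y)).
Qed.

End Linear.

Ltac lin1 :=
  match goal with
  | |- bilinear_map _ => split; intros
  | hyp : _ |- _ => exact: hyp
  | _ => first [ exact: lin_id | apply: lin_tmull | apply: lin_tmulr
    | apply: lin_mull | apply: lin_mulr | apply: lin_scaler
    | apply: lin_comul | apply: lin_antipode | apply: lin_coact
    | apply: lin_actl | apply: lin_actr | apply: lin_diar
    | apply: lin_tlift | apply: tlift_linear_fun; intros
    | match goal with hyp : linear _ |- _ => refine (lin_comp hyp _) end ]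
  end.

(* Proves linearity of [fun x => E] and bilinearity of [fun x y => E], E      *)
(* being built from the structure maps and from functions with a linearity    *)
(* proof in the context.                                                      *)
Ltac lin := repeat (progress lin1).

(** * Calculus of Sweedler sums *)

Lemma tlift_exchange (k : fieldType) (U V U' V' W : lmodType k)
    (t : U (x) V) (t' : U' (x) V') (b : U -> V -> U' -> V' -> W) :
  tlift t (fun u v => tlift t' (b u v)) =
  tlift t' (fun u' v' => tlift t (fun u v => b u v u' v')).
Proof.
have [s sE] := tlift_sum t; have [s' s'E] := tlift_sum t'.
rewrite sE s'E.
under eq_bigr do rewrite s'E scaler_sumr.
rewrite exchange_big; apply: eq_bigr => i _; rewrite sE scaler_sumr.
by apply: eq_bigr => j _; rewrite !scalerA mulrC.
Qed.

Lemma eq_tlift (k : fieldType) (U V W : lmodType k) (t : U (x) V)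
    (b b' : U -> V -> W) :
  (forall u v, b u v = b' u v) -> tlift t b = tlift t b'.
Proof. by move=> bb'; congr tlift; apply/funext => u; apply/funext => v. Qed.

(** Both sides are images of the coassociativity axiom under the linear map on M (x) (H (x) H)
    induced by [b]. *)
Lemma coassoc_tlift (k : fieldType) (H : hopfAlgebra k) (M W : lmodType k)
    (rho : M -> M (x) H) (b : M -> H -> H -> W) m :
  is_comodule rho -> trilinear_map b ->
  tlift (rho m) (fun m0 m1 => tlift (rho m0) (fun m00 m01 => b m00 m01 m1))
  = tlift (rho m) (fun m0 m1 => tlift (comul m1) (b m0)).
Proof.
move=> [_ coa _] [b1 b2 b3].
have bb2 m0 : bilinear_map (b m0) by lin.
have bb1 : bilinear_map (fun m0 (t : H (x) H) => tlift t (b m0)).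
  split=> [m0|t]; first exact: tlift_linear.
  exact: tlift_linear_fun.
have := congr1 (fun t => tlift t (fun m0 t => tlift t (b m0))) (coa m).
rewrite !(linear_tlift _ _ (tlift_linear bb1)).
under eq_tlift do rewrite (linear_tlift _ _ (tlift_linear bb1)).
under eq_tlift do under eq_tlift do rewrite !tlift_tmul //.
move=> ->; apply: eq_tlift => m0 m1.
by rewrite tlift_tmul.
Qed.

Lemma tlift0 (k : fieldType) (U V W : lmodType k) (t : U (x) V) :
  tlift t (fun _ _ => 0 : W) = 0.
Proof.
by have [s ->] := tlift_sum t; rewrite big1 // => i _; rewrite scaler0.
Qed.

(** * The antipode and its inverse *)

Section Hopf.

Variables (k : fieldType) (H : hopfAlgebra k).
Local Notation S := (@antipode k H).

(** Makes [coassoc_tlift] and [tlift_counitr] available for [comul]. *)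
Lemma comul_comodule : is_comodule (@comul k H).
Proof.
split; [exact: comul_linear | exact: comul_coassoc | exact: comul_counitr].
Qed.

Lemma tlift_counitr (M W : lmodType k) (rho : M -> M (x) H) (F : M -> W) m :
  is_comodule rho -> linear F ->
  tlift (rho m) (fun m0 m1 => counit m1 *: F m0) = F m.
Proof.
move=> [_ _ rho_counit] lF.
rewrite -[in RHS](rho_counit m) (linear_tlift _ _ lF).
by apply: eq_tlift => m0 m1; rewrite (scalable_linear lF).
Qed.

Lemma tlift_counitl (W : lmodType k) (F : H -> W) h : linear F ->
  tlift (comul h) (fun h1 h2 => counit h1 *: F h2) = F h.
Proof.
move=> lF; rewrite -[in RHS](comul_counitl h) (linear_tlift _ _ lF).
by apply: eq_tlift => m0 m1; rewrite (scalable_linear lF).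
Qed.

Lemma tlift_antipoder (W : lmodType k) (F : H -> W) h : linear F ->
  tlift (comul h) (fun h1 h2 => F (h1 * S h2)) = counit h *: F 1.
Proof.
by move=> lF; rewrite -(linear_tlift _ _ lF) antipoder (scalable_linear lF).
Qed.

(* Both sides equal \sum S(g_1 h_1) g_2 h_2 S(h_3) S(g_3). *)
Lemma antipodeM (g h : H) : S (g * h) = S h * S g.
Proof.
pose T g1 g2 g3 h1 h2 h3 := S (g1 * h1) * (g2 * (h2 * S h3) * S g3).
transitivity (tlift (comul g) (fun g1 g' => tlift (comul g') (fun g2 g3 =>
  tlift (comul h) (fun h1 h' => tlift (comul h') (fun h2 h3 =>
    T g1 g2 g3 h1 h2 h3))))).
  (* Contract h_2 S(h_3), then g_2 S(g_3), each to a counit. *)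
  under eq_tlift => g1 g'.
    under eq_tlift => g2 g3.
      under eq_tlift => h1 h'.
        rewrite (tlift_antipoder (F := fun z => S (g1 * h1) * (g2 * z * S g3))).
          rewrite mulr1; over.
        by lin.
      rewrite (tlift_counitr (F := fun z => S (g1 * z) * (g2 * S g3))
        _ comul_comodule); last by lin.
      over.
    rewrite (tlift_antipoder (F := fun z => S (g1 * h) * z)); last by lin.
    rewrite mulr1.
    over.
  by rewrite (tlift_counitr (F := fun z => S (z * h)) _ comul_comodule) //; lin.
have tT g1 g2 g3 : trilinear_map (T g1 g2 g3) by split; intros; rewrite /T; lin.
under eq_tlift do under eq_tlift do
  rewrite -(coassoc_tlift _ comul_comodule) //.
rewrite -(coassoc_tlift (b := fun g1 g2 g3 => tlift (comul h) (fun h1 h' =>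
  tlift (comul h1) (fun h1 h2 => T g1 g2 g3 h1 h2 h'))) _ comul_comodule);
  last first.
  by split; intros; rewrite /T; lin.
(* The other bracketing: S(g_1 h_1) g_2 h_2 is the antipode axiom for the product of g and h. *)
have E g1 h1 g3 h3 : tlift (comul g1) (fun g1 g2 => tlift (comul h1)
    (fun h1 h2 => T g1 g2 g3 h1 h2 h3))
    = counit h1 *: (counit g1 *: (S h3 * S g3)).
  have bF : bilinear_map (fun a b => S a * b * (S h3 * S g3)) by lin.
  transitivity (tlift (comul (g1 * h1)) (fun a b => S a * b * (S h3 * S g3))).
    rewrite comulM (linear_tlift _ _ (tlift_linear bF)).
    apply: eq_tlift => g1' g2.
    rewrite (linear_tlift _ _ (tlift_linear bF)).
    apply: eq_tlift => h1' h2.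
    by rewrite tlift_tmul // /T !mulrA.
  have lF : linear (fun z => z * (S h3 * S g3)) by lin.
  rewrite -(linear_tlift _ _ lF) antipodel (scalable_linear lF) mul1r counitM.
  by rewrite mulrC scalerA.
under eq_tlift => g1 g3.
  rewrite tlift_exchange.
  under eq_tlift do rewrite E.
  rewrite (tlift_counitl (F := fun z => counit g1 *: (S z * S g3)));
    last by lin.
  over.
by rewrite (tlift_counitl (F := fun z => S h * S z)) //; lin.
Qed.

Lemma antipode1 : S 1 = 1.
Proof.
have bF : bilinear_map (fun a b : H => S a * b) by lin.
have := antipodel (1 : H).
by rewrite comul1 tlift_tmul // mulr1 counit1 scale1r.
Qed.

Variables (psi : H -> H) (antipodeK : cancel S psi) (psiK : cancel psi S).

Lemma antipode_inv_linear : linear psi.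
Proof.
by move=> c x y; apply: (can_inj antipodeK); rewrite antipode_linear !psiK.
Qed.

(** Applying S, which reverses products, gives [antipodel]. *)
Lemma tlift_antipode_invl h :
  tlift (comul h) (fun h1 h2 => psi h2 * h1) = (counit h)%:A.
Proof.
apply: (can_inj antipodeK); rewrite (linear_tlift _ _ (@antipode_linear k H)).
under eq_tlift do rewrite antipodeM psiK.
by rewrite antipodel (scalable_linear (@antipode_linear k H)) antipode1.
Qed.

Lemma tlift_antipode_invr h :
  tlift (comul h) (fun h1 h2 => h2 * psi h1) = (counit h)%:A.
Proof.
apply: (can_inj antipodeK); rewrite (linear_tlift _ _ (@antipode_linear k H)).
under eq_tlift do rewrite antipodeM psiK.
by rewrite antipoder (scalable_linear (@antipode_linear k H)) antipode1.
Qed.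

End Hopf.

Lemma act_regular (k : fieldType) (H : hopfAlgebra k) (A : comodPoisson3Lie H)
    (a b : A) :
  @act _ _ _ (regularModule A) a b = a * b.
Proof. by []. Qed.

Section Integral.

Variables (k : fieldType) (H : hopfAlgebra k) (psi : H -> H).
Hypotheses (antipodeK : cancel (@antipode k H) psi)
  (psiK : cancel psi (@antipode k H)).
Variables (A : comodPoisson3Lie H) (phi : {rmorphism H -> A}).
Hypotheses (phi_scalable : forall (c : k) (h : H), phi (c *: h) = c *: phi h)
    (phi_colinear : forall h : H,
       coactA (phi h) = tlift (comul h) (fun h1 h2 => phi h1 (x) h2)).

Let lpsi : linear psi := antipode_inv_linear antipodeK psiK.

Let lphi : linear phi.
Proof. by move=> c x y; rewrite rmorphD phi_scalable. Qed.

(** * The projection onto the coinvariants *)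

Section Module.

Variable M : hopfModule A.
Let p := @coinv_proj k H A phi psi M.

Let Mmod := poisson_is_module (hopf_mod_poisson M).
Let Mcomod := hopf_mod_comodule M.

Lemma coinv_proj_linear : linear p.
Proof. by rewrite /p /coinv_proj; lin. Qed.

Lemma act_scalel c (a : A) (m : M) : act (c *: a) m = c *: act a m.
Proof. by rewrite (scalable_linear ((act_bilinear Mmod).2 m)). Qed.

Lemma act_scaler c (a : A) (m : M) : act a (c *: m) = c *: act a m.
Proof. by rewrite (scalable_linear ((act_bilinear Mmod).1 a)). Qed.

(** By coassociativity the sum is phi(n_2 psi(n_1)) . n_0, which [tlift_antipode_invr] contracts. *)
Lemma coinv_proj_decomp (n : M) :
  tlift (coact n) (fun n0 n1 => act (phi n1) (p n0)) = n.
Proof.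
have lp := coinv_proj_linear.
under eq_tlift => n0 n1.
  have la : linear (act (phi n1) : M -> M) by lin.
  rewrite /p /coinv_proj (linear_tlift _ _ la).
  under eq_tlift do rewrite -(actM Mmod) -rmorphM.
  over.
rewrite (coassoc_tlift (b := fun n0 n1 n2 => act (phi (n2 * psi n1)) n0)
  _ Mcomod); last by split; intros; lin.
under eq_tlift => n0 n1.
  have la : linear (fun h => act (phi h) n0) by lin.
  rewrite -(linear_tlift _ _ la) (tlift_antipode_invr antipodeK psiK).
  rewrite phi_scalable act_scalel rmorph1 (act1 Mmod).
  over.
by have [_ _ ->] := Mcomod.
Qed.

Lemma coact_act_coinv h (n : M) : coinv n ->
  coact (act (phi h) n) = tlift (comul h) (fun h1 h2 => act (phi h1) n (x) h2).
Proof.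
move=> /asboolP nE; rewrite coact_act phi_colinear nE.
have b1 : bilinear_map (fun (a0 : A) (a1 : H) =>
  tlift (n (x) (1 : H)) (fun m0 m1 => act a0 m0 (x) (a1 * m1))) by lin.
rewrite (linear_tlift _ _ (tlift_linear b1)); apply: eq_tlift => h1 h2.
by rewrite !tlift_tmul ?mulr1 //; lin.
Qed.

(** Colinearity of [phi] turns the left side into phi(psi(h_2) h_1) . n. *)
Lemma coinv_proj_act h (n : M) : coinv n -> p (act (phi h) n) = counit h *: n.
Proof.
move=> nc; rewrite /p /coinv_proj coact_act_coinv //.
have b1 : bilinear_map (fun (m0 : M) (m1 : H) => act (phi (psi m1)) m0) by lin.
rewrite (linear_tlift _ _ (tlift_linear b1)).
under eq_tlift do rewrite tlift_tmul // -(actM Mmod) -rmorphM.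
have lF : linear (fun h => act (phi h) n) by lin.
rewrite -(linear_tlift _ _ lF) (tlift_antipode_invl antipodeK psiK).
by rewrite phi_scalable act_scalel rmorph1 (act1 Mmod).
Qed.

Lemma coinv_proj_id (n : M) : coinv n -> p n = n.
Proof.
move=> nc; rewrite -[n in LHS](act1 Mmod) -(rmorph1 phi).
by rewrite coinv_proj_act // counit1 scale1r.
Qed.

(** The inner pair psi(h_3) h_2 contracts first; psi(h_4) h_1 then contracts in turn. *)
Lemma tlift_antipode_inv_act h (x : M) y :
  tlift (comul h) (fun h1 h2 => tlift (comul h1) (fun a b =>
    tlift (comul h2) (fun c d =>
      act (phi (psi d * a)) x (x) (psi c * b * y)))) = counit h *: (x (x) y).
Proof.
rewrite (coassoc_tlift (b := fun a b h2 => tlift (comul h2) (fun c d =>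
  act (phi (psi d * a)) x (x) (psi c * b * y))) _ (comul_comodule H));
  last by split; intros; lin.
under eq_tlift => a h'.
  rewrite -(coassoc_tlift (b := fun b c d =>
    act (phi (psi d * a)) x (x) (psi c * b * y)) _ (comul_comodule H));
    last by split; intros; lin.
  under eq_tlift => h'' d.
    have lF : linear (fun z => act (phi (psi d * a)) x (x) (z * y)) by lin.
    rewrite -(linear_tlift _ _ lF) (tlift_antipode_invl antipodeK psiK).
    rewrite (scalable_linear lF) mul1r.
    over.
  rewrite (tlift_counitl (F := fun d => act (phi (psi d * a)) x (x) y));
    last by lin.
  over.
have lF : linear (fun z => act (phi z) x (x) y) by lin.
rewrite -(linear_tlift _ _ lF) (tlift_antipode_invl antipodeK psiK).
by rewrite (scalable_linear lF) rmorph1 (act1 Mmod).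
Qed.

(* [coinv_proj_coinv] computes \sum untwist (coact n_0) n_1 in two ways: by   *)
(* coassociativity it is p(n) (x) 1, and expanding n_0 by [coinv_proj_decomp] *)
(* it is coact (p n).  This avoids the anticomultiplicativity of S.           *)
Let untwist (t : M (x) H) h := tlift t (fun x y => tlift (comul h) (fun h1 h2 =>
  act (phi (psi h2)) x (x) (psi h1 * y))).

Let untwist_bilinear : bilinear_map untwist.
Proof. by rewrite /untwist; lin. Qed.

Let untwist_tmul x y h :
  untwist (x (x) y) h = 
  tlift (comul h) (fun h1 h2 => act (phi (psi h2)) x (x) (psi h1 * y)).
Proof. by rewrite /untwist tlift_tmul //; lin. Qed.

(** [untwist] cancels phi(h_1) together with its coaction, by [tlift_antipode_inv_act]. *)
Let untwist_act h (m : M) :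
  tlift (comul h) (fun h1 h2 => untwist (coact (act (phi h1) m)) h2)
  = counit h *: coact m.
Proof.
have [ul ur] := untwist_bilinear.
under eq_tlift => h1 h2.
  have bF : bilinear_map (fun (a0 : A) (a1 : H) =>
    tlift (coact m) (fun m0 m1 => act a0 m0 (x) (a1 * m1))) by lin.
  rewrite coact_act phi_colinear (linear_tlift _ _ (tlift_linear bF)).
  under eq_tlift do rewrite tlift_tmul //.
  rewrite tlift_exchange (linear_tlift _ _ (ur h2)).
  under eq_tlift => m0 m1.
    rewrite (linear_tlift _ _ (ur h2)).
    under eq_tlift => a b.
      rewrite untwist_tmul.
      under eq_tlift do rewrite -(actM Mmod) -rmorphM mulrA.
      over.
    over.
  over.
rewrite /= tlift_exchange.
under eq_tlift do rewrite tlift_antipode_inv_act.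
have lF : linear (fun z : M (x) H => counit h *: z) by lin.
by rewrite -(linear_tlift _ _ lF) tlift_id.
Qed.

Let untwist_coact (n : M) :
  tlift (coact n) (fun n0 n1 => untwist (coact n0) n1) = p n (x) (1 : H).
Proof.
rewrite (coassoc_tlift (b := fun n0 n1 h => tlift (comul h) (fun h1 h2 =>
  act (phi (psi h2)) n0 (x) (psi h1 * n1))) _ Mcomod); last first.
  by split; intros; lin.
have lt : linear (fun z : M => z (x) (1 : H)) by lin.
rewrite /p /coinv_proj (linear_tlift _ _ lt); apply: eq_tlift => n0 h.
rewrite -(coassoc_tlift (b := fun n1 h1 h2 =>
  act (phi (psi h2)) n0 (x) (psi h1 * n1)) _ (comul_comodule H)); last first.
  by split; intros; lin.
under eq_tlift => h' h2.
  have lF : linear (fun z : H => act (phi (psi h2)) n0 (x) z) by lin.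
  rewrite -(linear_tlift _ _ lF) (tlift_antipode_invl antipodeK psiK).
  rewrite (scalable_linear lF).
  over.
by rewrite (tlift_counitl (F := fun h2 => act (phi (psi h2)) n0 (x) 1)) //; lin.
Qed.

Lemma coinv_proj_coinv (n : M) : coinv (p n).
Proof.
apply/asboolP; rewrite -untwist_coact.
have lp := coinv_proj_linear; have [ul ur] := untwist_bilinear.
have lc := coact_linear Mcomod.
have E n0 n1 : untwist (coact n0) n1 = tlift (coact n0) (fun n00 n01 =>
    untwist (coact (act (phi n01) (p n00))) n1).
  rewrite -{1}[n0]coinv_proj_decomp (linear_tlift _ _ lc).
  exact: (linear_tlift _ _ (ur n1)).
under eq_tlift do rewrite E.
rewrite (coassoc_tlift (b := fun n0 n1 n2 =>
  untwist (coact (act (phi n1) (p n0))) n2) _ Mcomod); last first.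
  split=> *; last exact: ul.
    by apply: (lin_comp (ur _)); lin.
  by apply: (lin_comp (ur _)); lin.
under eq_tlift do rewrite untwist_act.
by rewrite (tlift_counitr (F := fun z => coact (p z)) _ Mcomod) //; lin.
Qed.

(** * Vanishing of the 3-Lie actions *)

Hypotheses (phi_center : forall h : H, poisson_center (phi h))
  (trivM : coinv_trivial phi psi M).

(** Each term of the [coinv_proj_decomp] expansion contains p((x_0, y_0) <> n), zero by [trivM]. *)
Lemma dia_coinv (x y : A) (n : M) : coinv n -> dia x y n = 0.
Proof.
move=> nc; have /asboolP nE := nc; have lp := coinv_proj_linear.
rewrite -[LHS]coinv_proj_decomp coact_dia nE.
have bF : bilinear_map (fun (m0 : M) (m1 : H) => act (phi m1) (p m0)) by lin.
rewrite (linear_tlift _ _ (tlift_linear bF)) -[RHS](tlift0 _ (coactA x)).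
apply: eq_tlift => x0 x1.
rewrite (linear_tlift _ _ (tlift_linear bF)) -[RHS](tlift0 _ (coactA y)).
apply: eq_tlift => y0 y1.
rewrite tlift_tmul; last by lin.
rewrite tlift_tmul // [p _](trivM x0 y0 nc).
by have [-> _ _ _] := linear_props ((act_bilinear Mmod).1 (phi (x1 * y1 * 1))).
Qed.

(** On phi(m_1) . p(m_0) the Leibniz rule leaves a bracket with the central phi(m_1) and an action
    on a coinvariant. *)
Lemma dia_eq0 (x y : A) (m : M) : dia x y m = 0.
Proof.
have ld : linear (dia x y : M -> M) by lin.
rewrite -[m]coinv_proj_decomp (linear_tlift _ _ ld) -[RHS](tlift0 _ (coact m)).
apply: eq_tlift => m0 m1; rewrite (dia_act (hopf_mod_poisson M)).
have [_ s12 s23 _] := bracket_3Lie A.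
(* Two transpositions move [phi m1] to the first slot, where [poisson_center] applies. *)
rewrite dia_coinv ?coinv_proj_coinv // s23 s12 opprK.
have /asboolP -> := phi_center m1.
have [-> _ _ _] := linear_props ((act_bilinear Mmod).2 (p m0)).
have [-> _ _ _] := linear_props ((act_bilinear Mmod).1 (phi m1)).
by rewrite addr0.
Qed.

Lemma coinv_inv_coinv (n : M) : coinv n -> inv_coinv n.
Proof.
move=> nc; apply/andP; split=> //; apply/asboolP => x y; exact: dia_eq0.
Qed.

End Module.

Hypotheses (phi_center : forall h : H, poisson_center (phi h))
  (trivM : forall M : hopfModule A, coinv_trivial phi psi M).

(** The bracket is the 3-Lie action on the regular module, so [dia_eq0] kills it on all of A. *)
Lemma coinvA_inv_coinvA (b : A) :
  coinv (b : regularModule A) -> inv_coinvA b.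
Proof.
move=> bc; apply/andP; split=> //; apply/asboolP => x y.
exact: (dia_eq0 phi_center (@trivM (regularModule A)) b x
  (y : regularModule A)).
Qed.

(** * Extending a B-linear section to a morphism *)

Section Lifting.

Variables (X Y : hopfModule A) (s : {linear invMod Y -> invMod X}).

Let Xmod := poisson_is_module (hopf_mod_poisson X).
Let Ymod := poisson_is_module (hopf_mod_poisson Y).

Let p (m : Y) := coinv_proj phi psi m.

Let inv_proj (m : Y) : invMod Y :=
  exist _ (p m) (coinv_inv_coinv phi_center (@trivM Y) (coinv_proj_coinv m)).

Let s_proj (m : Y) : X := val (s (inv_proj m)).

(** [s] is given as B-linear only; having the scalars inside B makes [s_proj] k-linear, as Sweedler
    sums require. *)
Lemma inv_coinvA_scalar c : inv_coinvA (c *: (1 : A)).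
Proof.
apply: coinvA_inv_coinvA; apply/asboolP.
rewrite [LHS](scalable_linear (coact_linear (coactA_comodule A))) coactA1.
by rewrite [RHS](scalable_linear ((tmul_bilinear A H).2 1)).
Qed.

Let s_proj_linear : linear s_proj.
Proof.
move=> c x y.
pose cB : invRing A := exist _ (c *: (1 : A)) (inv_coinvA_scalar c).
have lp : linear p := @coinv_proj_linear Y.
have E : inv_proj (c *: x + y) = cB *: inv_proj x + inv_proj y.
  by apply: val_inj; rewrite /= lp act_scalel (act1 Ymod).
by rewrite /s_proj E linearP /= act_scalel (act1 Xmod).
Qed.

Let s_proj_act h n : coinv n -> s_proj (act (phi h) n) = counit h *: s_proj n.
Proof.
move=> nc; rewrite -(scalable_linear s_proj_linear); congr (val (s _)).
apply: val_inj => /=; have lp : linear p := @coinv_proj_linear Y.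
rewrite (scalable_linear lp) [LHS]coinv_proj_act //.
by rewrite [p n]coinv_proj_id.
Qed.

Let s_proj_actB (b : A) n : inv_coinvA b -> coinv n ->
  s_proj (act b n) = act b (s_proj n).
Proof.
move=> bi nc; pose bB : invRing A := exist _ b bi.
suff E : inv_proj (act b n) = bB *: inv_proj n by rewrite /s_proj E linearZ.
have ni := coinv_inv_coinv phi_center (@trivM Y) nc.
have /andP[_ bnc] := inv_coinv_act bi ni.
by apply: val_inj; rewrite /= /p !coinv_proj_id.
Qed.

Lemma s_proj_coinv m : coinv (s_proj m).
Proof. by have /andP[] := valP (s (inv_proj m)). Qed.

(** A formula, free of choices, for the map sending phi(h) . n to phi(h) . s(n) when n is
    coinvariant; see [coinv_lift_act_coinv]. *)
Definition coinv_lift (m : Y) : X :=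
  tlift (coact m) (fun m0 m1 => act (phi m1) (s_proj m0)).

Lemma coinv_lift_linear : linear coinv_lift.
Proof. by rewrite /coinv_lift; lin; apply: (lin_comp s_proj_linear). Qed.

Lemma coinv_lift_act_coinv h (n : Y) : coinv n ->
  coinv_lift (act (phi h) n) = act (phi h) (s_proj n).
Proof.
move=> nc; have ls := s_proj_linear.
have bF : bilinear_map (fun (m0 : Y) (m1 : H) => act (phi m1) (s_proj m0)).
  by split=> ?; [lin | apply: lin_actr].
rewrite /coinv_lift coact_act_coinv // (linear_tlift _ _ (tlift_linear bF)).
under eq_tlift => h1 h2.
  rewrite tlift_tmul // s_proj_act // act_scaler.
  over.
by rewrite (tlift_counitl (F := fun h => act (phi h) (s_proj n))) //; lin.
Qed.

(** Decomposing both [m] and [a] reduces to phi(g) b' acting on phi(h) . n', with b' in B and n'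
    coinvariant. *)
Lemma coinv_lift_act (a : A) (m : Y) :
  coinv_lift (act a m) = act a (coinv_lift m).
Proof.
have ll := coinv_lift_linear.
have lla : linear (fun m => act a (coinv_lift m)) by apply: lin_actr.
have lal : linear (fun m => coinv_lift (act a m)) by apply: (lin_comp ll); lin.
rewrite -[m]coinv_proj_decomp (linear_tlift _ _ lla) (linear_tlift _ _ lal).
apply: eq_tlift => n h; set n' := coinv_proj _ _ n.
have nc : coinv n' by apply: coinv_proj_coinv.
have l1 : linear (fun a : regularModule A =>
    coinv_lift (act (a : A) (act (phi h) n'))).
  by apply: (lin_comp ll); lin.
have l2 : linear (fun a : regularModule A =>
  act (a : A) (coinv_lift (act (phi h) n'))) by lin.
rewrite -[a](coinv_proj_decomp (M := regularModule A)).
rewrite (linear_tlift _ _ l1) (linear_tlift _ _ l2).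
apply: eq_tlift => b g; set b' : A := coinv_proj _ _ b.
have bc : coinv (b' : regularModule A) by apply: coinv_proj_coinv.
have bi := coinvA_inv_coinvA bc.
have ni := coinv_inv_coinv phi_center (@trivM Y) nc.
have /andP[_ bnc] := inv_coinv_act bi ni.
(* Commutativity brings b' next to n', where B-linearity of [s] applies. *)
have E : phi g * b' * phi h = phi (g * h) * b' by rewrite rmorphM mulrAC.
rewrite act_regular coinv_lift_act_coinv // -(actM Xmod) -(actM Ymod) E.
by rewrite (actM Xmod) (actM Ymod) coinv_lift_act_coinv // s_proj_actB.
Qed.

(** Values of [s] are coinvariant, so only phi(m_1) contributes to the coaction; coassociativity
    concludes. *)
Lemma coinv_lift_coact (m : Y) :
  coact (coinv_lift m) = tlift (coact m) (fun m0 m1 => coinv_lift m0 (x) m1).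
Proof.
have lc : linear (fun x : X => coact x) by lin.
have ls := s_proj_linear.
rewrite /coinv_lift (linear_tlift _ _ lc).
under eq_tlift do rewrite coact_act_coinv ?s_proj_coinv //.
rewrite -(coassoc_tlift (b := fun m0 h1 h2 => act (phi h1) (s_proj m0) (x) h2)
  _ (hopf_mod_comodule Y)); last first.
  by split; intros; lin; apply: lin_actr.
apply: eq_tlift => m0 m1.
have lt : linear (fun z : X => z (x) m1) by lin.
by rewrite (linear_tlift _ _ lt).
Qed.

Lemma coinv_lift_dia (x y : A) (m : Y) :
  coinv_lift (dia x y m) = dia x y (coinv_lift m).
Proof.
have [l0 _ _ _] := linear_props coinv_lift_linear.
by rewrite (dia_eq0 phi_center (@trivM Y)) (dia_eq0 phi_center (@trivM X)).
Qed.

HB.instance Definition _ :=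
  GRing.isLinear.Build k Y X _ coinv_lift coinv_lift_linear.

Definition coinv_lift_hom : hopfModuleHom Y X :=
  @HopfModuleHom _ _ _ Y X coinv_lift
    coinv_lift_act coinv_lift_dia coinv_lift_coact.

(** By A-linearity [i] replaces s(p(m_0)) by p(m_0), leaving the decomposition of m. *)
Lemma coinv_liftK (i : hopfModuleHom X Y) :
  (forall n, inv_hom i (s n) = n) -> cancel coinv_lift i.
Proof.
move=> isK m; have li : linear i by exact: linearP.
rewrite /coinv_lift (linear_tlift _ _ li) -[RHS]coinv_proj_decomp.
apply: eq_tlift => m0 m1; rewrite hom_act; congr act.
exact: (congr1 val (isK (inv_proj m0))).
Qed.

End Lifting.
End Integral.

Theorem corollary3p11 (k : fieldType) (char0 : [pchar k] =i pred0)
    (H : hopfAlgebra k)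
    (psi : H -> H)
    (antipodeK : cancel (@antipode k H) psi)
    (psiK : cancel psi (@antipode k H))
    (A : comodPoisson3Lie H)
    (phi : {rmorphism H -> A})
    (phi_scalable : forall (c : k) (h : H), phi (c *: h) = c *: phi h)
    (phi_center : forall h : H, poisson_center (phi h))
    (phi_colinear : forall h : H,
       coactA (phi h) = tlift (comul h) (fun h1 h2 => phi h1 (x) h2))
    (trivM : forall M : hopfModule A, coinv_trivial phi psi M)
    (trivA : coinv_trivial phi psi (regularModule A)) :
  dual_maschke (invFunctor A).
Proof.
move=> P X Y i [s isE] f.
pose g := coinv_lift_hom antipodeK psiK phi_scalable phi_colinear
  phi_center trivM s.
exists (hopf_comp g f); apply: hopf_hom_ext => m /=.
rewrite coinv_liftK // => n.
exact: (congr1 (fun h : {linear invMod Y -> invMod Y} => h n) isE).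
Qed.
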